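(* Let $\mathcal{I} = (I_1, \dots, I_n)$ be a Grassmann necklace of type $(k,n)$. Then the procedure (N$\to$L) described in the context, applied to $\mathcal{I}$, is well defined and constructs the Le diagram associated to $\mathcal{I}$: its output $\mathcal{L}(\mathcal{I})$ is a Le diagram of type $(k,n)$, and it is the unique Le diagram $L$ of type $(k,n)$ such that $\mathcal{I}(L) = \mathcal{I}$, where $\mathcal{I}(L)$ denotes the Grassmann necklace of $L$ obtained by the procedure (L$\to$N) described in the context.
   Context: Write $[n] = \{1, 2, \dots, n\}$, and let $0 \le k \le n$. **Labelled Young diagrams.** Given a Young diagram (left- and top-justified) fitting inside a $k \times (n-k)$ box, its southeast border is regarded as the lattice path with $n$ unit steps from the northeast corner to the southwest corner of the $k\times(n-k)$ box. The steps are numbered $1, \dots, n$ in order starting from the northeast corner; each vertical step labels the row it ends, and each horizontal step labels the column it bounds (empty rows and columns also receive labels). So the $k$ row labels increase from top to bottom, and the $n-k$ column labels increase from right to left. A square is denoted $(r,c)$, with $r$ its row label and $c$ its column label; a square with row label $r$ and column label $c$ exists in the diagram if and only if $r < c$. A Young diagram in the box is determined by its set of row labels, which can be any $k$-element subset of $[n]$. **Le diagram of type $(k,n)$.** A Young diagram fitting inside a $k\times(n-k)$ box, with each square filled with $+$ or $0$, such that: whenever $i<p$ and $j<l$ and the squares $(i,j)$ and $(p,l)$ both contain a $+$, the square $(p,j)$ (if it exists) also contains a $+$. **Grassmann necklace of type $(k,n)$.** A sequence $\mathcal{I} = (I_1, \dots, I_n)$ of $k$-element subsets of $[n]$ such that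 for every $i \in [n]$ (indices mod $n$, so $I_{n+1} = I_1$): if $i \in I_i$, then $I_{i+1} = (I_i \setminus \{i\}) \cup \{j\}$ for some $j \in [n]$ (with $j=i$ allowed); if $i \notin I_i$, then $I_{i+1} = I_i$. **Northwest.** A square $(i,j)$ is strictly northwest of $(p,l)$ if $i<p$ and $j>l$, and weakly northwest of $(p,l)$ if $i \le p$ and $j \ge l$. In a Le diagram, among the $+$ squares strictly (resp. weakly) northwest of a given square there is either none, or a unique nearest one, namely the one such that all the others are weakly northwest of it. **Procedure (L$\to$N) (Oh's algorithm).** Let $L$ be a Le diagram of type $(k,n)$. Label the squares along the southeast boundary of $L$ by $\overline{2}, \dots, \overline{n}$ starting from the northeast corner: $\overline{i}$ is the square whose southeast corner is the border point between border steps $i-1$ and $i$. Thus the squares weakly northwest of $\overline{i}$ are exactly the squares $(r,c)$ of the diagram with $r < i \le c$ (if there are no such squares, the path below is empty). Let $I_1$ be the set of row labels of $L$. For $2 \le i \le n$, the path from $\overline{i}$ starts in the unique nearest $+$ square weakly northwest of $\overline{i}$ (possibly $\overline{i}$ itself), then repeatedly steps to the unique nearest $+$ square strictly northwest of the current position, until no further step is possible; if no $+$ square is weakly northwest of $\overline{i}$, the path is empty. Set $$I_i = \bigl(I_1 \setminus \{\text{row labels of squares in the path}\}\bigr) \cup \{\text{column labels of squares in the path}\}.$$ The resulting sequence is $\mathcal{I}(L) = (I_1, \dots, I_n)$, the Grassmann necklace of $L$. **Procedure (N$\to$L).** Let $\mathcal{I} = (I_1, \dots, I_n)$ be a Grassmann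 necklace of type $(k,n)$. (1) In a $k \times (n-k)$ box, draw the Young diagram whose rows are labelled by $I_1$. (2) For each $i$ with $2 \le i \le n$, write $I_1 \setminus I_i = \{a_1 > a_2 > \dots > a_r\}$ and $I_i \setminus I_1 = \{b_1 < b_2 < \dots < b_r\}$, and place a $+$ in each of the squares $(a_1,b_1), (a_2,b_2), \dots, (a_r,b_r)$. (3) After doing this for all $i$, place a $0$ in every remaining unfilled square. The resulting filled diagram is denoted $\mathcal{L}(\mathcal{I})$. *)

(* Defs.v *)
(* The ground set [n.+1] = {1, ..., n.+1} is represented by 'I_n.+1: the label
   i is the ordinal of value i - 1, so the label 1 is ord0.  All comparisons
   between labels are unaffected by this shift. *)
From mathcomp Require Import all_boot.

Set Implicit Arguments.
Unset Strict Implicit.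
Unset Printing Implicit Defensive.

Section Diagrams.

Variable n : nat.

Local Notation label := 'I_n.+1.
Local Notation square := (label * label)%type.

(* A Young diagram in the k x (n.+1 - k) box is given by the set of its row
   labels, the other labels being column labels; a filling by + and 0 is given
   by the set of squares that contain a +. *)
Record filled_diagram := FilledDiagram {
  rows : {set label};
  pluses : {set square}
}.

Definition squares (R : {set label}) : {set square} :=
  [set s : square | [&& s.1 \in R, s.2 \notin R & s.1 < s.2]].

Definition le_diagram (k : nat) (L : filled_diagram) : Prop :=
  [/\ #|rows L| = k,
      pluses L \subset squares (rows L)
    & forall i j p l : label,
        i < p -> j < l ->
        (i, j) \in pluses L -> (p, l) \in pluses L ->
        (p, j) \in squares (rows L) -> (p, j) \in pluses L].

Definition grassmann_necklace (k : nat) (I : {ffun label -> {set label}}) :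
    Prop :=
  forall i : label,
    #|I i| = k /\
    (if i \in I i then exists j : label, I (ordS i) = j |: (I i :\ i)
     else I (ordS i) = I i).

Definition strictly_nw (s t : square) : bool := (s.1 < t.1) && (s.2 > t.2).
Definition weakly_nw (s t : square) : bool := (s.1 <= t.1) && (s.2 >= t.2).

Definition nearest (A : {set square}) : option square :=
  [pick q in A | [forall s in A, weakly_nw s q]].

Definition pluses_nw_of_border (L : filled_diagram) (i : label) :
    {set square} :=
  [set s in pluses L | s.1 < i <= s.2].

Definition pluses_nw_of (L : filled_diagram) (q : square) : {set square} :=
  [set s in pluses L | strictly_nw s q].

(* Row labels strictly decrease along the path, so n.+1 steps always suffice:
   see nw_path_fuel below. *)
Fixpoint nw_path (L : filled_diagram) (fuel : nat) (A : {set square}) :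
    seq square :=
  if fuel is fuel'.+1 then
    if nearest A is Some q then q :: nw_path L fuel' (pluses_nw_of L q)
    else [::]
  else [::].

Definition oh_path (L : filled_diagram) (i : label) : seq square :=
  nw_path L n.+1 (pluses_nw_of_border L i).

Definition necklace_of_diagram (L : filled_diagram) :
    {ffun label -> {set label}} :=
  [ffun i => if i == ord0 then rows L else
     (rows L :\: [set r in [seq s.1 | s <- oh_path L i]])
       :|: [set c in [seq s.2 | s <- oh_path L i]]].

(* enum lists the elements of a set of ordinals in increasing order. *)
Definition placed_pluses (I : {ffun label -> {set label}}) (i : label) :
    seq square :=
  zip (rev (enum (I ord0 :\: I i))) (enum (I i :\: I ord0)).

Definition diagram_of_necklace (I : {ffun label -> {set label}}) :
    filled_diagram :=
  FilledDiagram (I ord0)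
    (\bigcup_(i | i != ord0) [set s in placed_pluses I i]).

(* The two lists that are paired have the same length, and each + is placed in
   an existing square of the diagram. *)
Definition diagram_of_necklace_well_defined
    (I : {ffun label -> {set label}}) : Prop :=
  forall i : label, i != ord0 ->
    #|I ord0 :\: I i| = #|I i :\: I ord0| /\
    {subset placed_pluses I i <= squares (I ord0)}.

(* Sanity checks: in a Le diagram, the nearest + exists as soon as there is a
   candidate, it is unique, and the bound on the length of paths is harmless. *)

Lemma nearestP (A : {set square}) (q : square) :
  nearest A = Some q <-> q \in A /\ {in A, forall s, weakly_nw s q}.
Proof.
have anti s t : weakly_nw s t -> weakly_nw t s -> s = t.
  case: s t => [a b] [c d] /andP[/= h1 h2] /andP[/= h3 h4].
  by congr pair; apply/val_inj/eqP; rewrite eqn_leq ?h1 ?h2 ?h3 ?h4.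
rewrite /nearest; split.
  by case: pickP => // x /andP[xA /forall_inP hx] [<-].
move=> [qA hq]; case: pickP => [x /andP[xA /forall_inP hx]|/(_ q)].
  by congr Some; apply: anti; [exact: hq|exact: hx].
by rewrite qA /=; move/negbT/forall_inPn => [s sA]; rewrite hq.
Qed.

Lemma le_diagram_nearest (k : nat) (L : filled_diagram) (a b : nat) :
  le_diagram k L -> a <= b ->
  let A := [set s in pluses L | s.1 < a & b <= s.2] in
  A != set0 -> nearest A != None.
Proof.
move=> [_ /subsetP sub hle] ab A /set0Pn[s0 s0A].
case: (arg_maxnP (fun s : square => s.1 : nat) s0A) => [[p l] sA hs].
case: (arg_minnP (fun s : square => s.2 : nat) s0A) => [[i j] tA ht].
suff pjA : (p, j) \in A.
  have /nearestP -> // : (p, j) \in A /\ {in A, forall s, weakly_nw s (p, j)}.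
  by split=> // s sA'; apply/andP; split; [exact: hs | exact: ht].
have := hs _ tA; have := ht _ sA => /=.
rewrite leq_eqVlt => /orP[/eqP/val_inj -> //|jl].
rewrite leq_eqVlt => /orP[/eqP/val_inj <- //|ip].
move: (sA : (p, l) \in A) (tA : (i, j) \in A); rewrite /A !inE /= => /and3P[sL pa bl] /and3P[tL ia bj].
rewrite pa bj (hle _ _ _ _ ip jl tL sL) // inE /=.
have := sub _ sL; have := sub _ tL; rewrite !inE /=.
move=> /and3P[_ -> _] /and3P[-> _ _] /=.
exact: leq_trans pa (leq_trans ab bj).
Qed.

Lemma nearest_pluses_nw_of_border (k : nat) (L : filled_diagram) (i : label) :
  le_diagram k L -> pluses_nw_of_border L i != set0 ->
  nearest (pluses_nw_of_border L i) != None.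
Proof. by move=> hL; apply: (le_diagram_nearest hL). Qed.

Lemma nearest_pluses_nw_of (k : nat) (L : filled_diagram) (q : square) :
  le_diagram k L -> q \in pluses L -> pluses_nw_of L q != set0 ->
  nearest (pluses_nw_of L q) != None.
Proof.
move=> hL qL; apply: (le_diagram_nearest hL).
case: hL => _ /subsetP/(_ _ qL); rewrite inE => /and3P[_ _ h] _.
exact: leqW (ltnW h).
Qed.

Lemma nw_path_fuel (L : filled_diagram) (m m' : nat) (A : {set square}) :
  {in A, forall s : square, s.1 < m} -> m <= m' -> nw_path L m' A = nw_path L m A.
Proof.
elim: m m' A => [|m IH] [|m'] A hA //= hm.
  by case E: (nearest A) => [q|//]; have /nearestP[/hA] := E.
case E: (nearest A) => [q|//]; congr cons; apply: IH => // s.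
have /nearestP[/hA hq _] := E.
by rewrite inE => /andP[_ /andP[h _]]; apply: leq_trans h _.
Qed.

End Diagrams.

(* Main.v *)
Require Import Defs.
From mathcomp Require Import all_boot zify.

Set Implicit Arguments.
Unset Strict Implicit.
Unset Printing Implicit Defensive.

(** Write R for the first set of the necklace and think of the index z of I_z as
   a time.  Step z changes I_z only by removing z and inserting some j.  Hence a
   label smaller than z that lies in I_z lies in R (once inserted it stays until
   the end of the cycle), and a label at least z that lies in R lies in I_z.  So
   the labels of R :\: I_z are smaller than z, those of I_z :\: R are at least z,
   and the squares placed at time z exist.

   Existence rests on the number of labels of I_z in an interval [a, b).
   In the pairing at time z, the square (r, c) occurs if and only if r is in
   R :\: I_z, c is in I_z :\: R, and R and I_z have equally many labels strictly
   between r and c ([mem_placed]): this says that as many row labels exceed r as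
   column labels precede c.  Moreover, while the time z runs through [a, b), each
   step removes a label of the interval whenever it inserts one, so the count
   never increases ([at_card_mono]), and it drops by at most one, so it takes
   every intermediate value ([at_ivt]).

   Le property.  Let (i, j) be placed at time x and (p, l) at time y, with
   i < p < j < l.  Counting labels in (p, j), the first placement bounds the count
   below by that of R at time max(x, p+1), the second bounds it above at time
   min(y, j).  These times come in this order ([plus_at_order]), so at some time
   between them the count equals that of R, and (p, j) is placed then.

   Paths.  Consider the region of the squares with row label below a and column
   label at least b, where a <= i <= b, and suppose that R and I_i have equally
   many labels in [a, b).  If a square of the region is placed at a time after i,
   monotonicity of counts forces its column to be weakly left of the first column
   of I_i :\: R available in the region; a time before i is handled in the same
   way by rows ([plus_at_after], [plus_at_before]).  So the nearest plus in the
   region is the next square placed at time i, and walking northwest reads off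
   exactly the pairs placed at time i ([nw_path_zip]).

   Uniqueness.  In a Le diagram L, every plus lies on the path of some border
   square: a region in which the plus is nearest can be enlarged towards the
   border, either for free, or by a corner plus whose path continues with the
   given one ([nearest_region_oh_path]).  The path from border i is a chain, so it
   is recovered from its row and column labels, which are the two differences of
   I_1 and I_i.  Thus the placed squares of the necklace of L are exactly the
   pluses of L. *)

(** * Counting labels in intervals *)

Section Intervals.

Variable n : nat.
Local Notation label := 'I_n.+1.
Implicit Types (S T : {set label}) (x r c : label).

Definition itv (a b : nat) : {set label} := [set x : label | a <= x < b].

Definition mass S (a b : nat) : nat := #|S :&: itv a b|.

Lemma mass_cat S (a b c : nat) : a <= b -> b <= c ->
  mass S a c = mass S a b + mass S b c.
Proof.
move=> ab bc; rewrite /mass -cardsUI.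
have -> : S :&: itv a b :&: (S :&: itv b c) = set0.
  by apply/setP => x; rewrite !inE; lia.
rewrite cards0 addn0 -setIUr; congr #|pred_of_set (_ :&: _)|.
by apply/setP => x; rewrite !inE; lia.
Qed.

Lemma mass1 S x : mass S x x.+1 = (x \in S).
Proof.
rewrite /mass; have -> : itv x x.+1 = [set x].
  by apply/setP => y; rewrite !inE -val_eqE /=; lia.
rewrite setIC; case: (boolP (x \in S)) => xS.
  by rewrite (setIidPl _) ?cards1 ?sub1set.
by apply/eqP; rewrite cards_eq0 setI_eq0 disjoints1.
Qed.

Lemma mass_recl S x b : x < b -> mass S x b = (x \in S) + mass S x.+1 b.
Proof. by move=> xb; rewrite (@mass_cat S x x.+1 b) // mass1. Qed.

Lemma mass_recr S a x : a <= x -> mass S a x.+1 = mass S a x + (x \in S).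
Proof. by move=> ax; rewrite (@mass_cat S a x x.+1) // mass1. Qed.

Lemma le_mass S T a b :
  (forall x, a <= x < b -> x \in S -> x \in T) -> mass S a b <= mass T a b.
Proof.
move=> h; apply/subset_leq_card/subsetP => x; rewrite !inE => /andP[xS xab].
by rewrite xab h.
Qed.

Lemma eq_mass S T a b :
  (forall x, a <= x < b -> (x \in S) = (x \in T)) -> mass S a b = mass T a b.
Proof. by move=> h; apply/anti_leq/andP; split; apply: le_mass => x /h ->. Qed.

(** In a pairing of a decreasing list with an increasing one, both entries of a
   pair have the same rank in their lists. *)
Lemma mem_zip_sorted (s t : seq label) r c :
  sorted (fun x y : label => y < x) s -> sorted (fun x y : label => x < y) t ->
  size s = size t ->
  ((r, c) \in zip s t) =
    [&& r \in s, c \in t & count (fun x : label => r < x) s ==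
                           count (fun x : label => x < c) t].
Proof.
elim: s t => [|a s IH] [|b t] //= sa tb [sz].
have as_ : {in s, forall x : label, x < a}.
  by apply/allP; apply: order_path_min sa => x y z /=; lia.
have bt : {in t, forall x : label, b < x}.
  by apply/allP; apply: order_path_min tb => x y z /=; lia.
rewrite in_cons (IH _ (path_sorted sa) (path_sorted tb) sz) !in_cons xpair_eqE.
have [->|ra] := eqVneq r a; have [->|cb] := eqVneq c b => /=.
- rewrite !ltnn /=; apply/esym/eqP.
  rewrite (eq_in_count (a2 := pred0)) ?count_pred0; last first.
    by move=> x /as_ /=; lia.
  rewrite (eq_in_count (a2 := pred0)) ?count_pred0 //.
  by move=> x /bt /=; lia.
- rewrite ltnn add0n.
  have -> : (a \in s) = false by apply/negP => /as_; rewrite ltnn.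
  case: (boolP (c \in t)) => //= ct; rewrite (bt _ ct).
  rewrite (eq_in_count (a2 := pred0)) ?count_pred0 //.
  by move=> x /as_ /=; lia.
- rewrite ltnn add0n.
  have -> : (b \in t) = false by apply/negP => /bt; rewrite ltnn.
  case: (boolP (r \in s)) => //= rs; rewrite (as_ _ rs).
  rewrite [count _ t](eq_in_count (a2 := pred0)) ?count_pred0 //.
  by move=> x /bt /=; lia.
case: (boolP (r \in s)) => //= rs; case: (boolP (c \in t)) => //= ct.
by rewrite (as_ _ rs) (bt _ ct).
Qed.

Lemma sorted_enum (A : {set label}) :
  sorted (fun x y : label => x < y) (enum A).
Proof.
rewrite [enum _]/enum_mem -enumT; apply: sorted_filter => [x y z /=|]; first by lia.
by have := iota_ltn_sorted 0 n.+1; rewrite -val_enum_ord sorted_map.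
Qed.

Lemma sorted_rev_enum (A : {set label}) :
  sorted (fun x y : label => y < x) (rev (enum A)).
Proof. by rewrite rev_sorted; apply: sorted_enum. Qed.

Lemma count_enum (A : {set label}) (P : pred label) :
  count P (enum A) = #|A :&: [set x | P x]|.
Proof.
rewrite -size_filter cardE -filter_predI; congr size.
by apply: eq_filter => x; rewrite /= !inE andbC.
Qed.

End Intervals.

(** * Northwest paths *)

Section Paths.

Variable n : nat.
Local Notation label := 'I_n.+1.
Implicit Type L : filled_diagram n.

(** Both kinds of candidate sets met along a path have this shape, so that
   inductions along paths only involve the two bounds. *)
Definition region L (a b : nat) : {set label * label} :=
  [set s in pluses L | s.1 < a & b <= s.2].

Lemma pluses_nw_of_border_region L (i : label) :
  pluses_nw_of_border L i = region L i i.
Proof. by []. Qed.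

Lemma pluses_nw_of_region L (q : label * label) : pluses_nw_of L q = region L q.1 q.2.+1.
Proof. by []. Qed.

Lemma nw_path_region L fuel a b : {subset nw_path L fuel (region L a b) <= region L a b}.
Proof.
elim: fuel a b => //= fuel IH a b s.
case E: nearest => [q|//]; have [qA _] := (nearestP _ _).1 E.
rewrite inE => /predU1P[-> //|]; rewrite pluses_nw_of_region => /IH.
move: qA; rewrite !inE => /and3P[_ qa bq] /and3P[-> sq qs] /=.
by rewrite (ltn_trans sq qa) (leq_trans bq (ltnW qs)).
Qed.

Lemma nw_path_sorted L fuel (A : {set label * label}) :
  sorted (fun s t => strictly_nw t s) (nw_path L fuel A).
Proof.
case: fuel => //= fuel; case: nearest => //= q {A}.
elim: fuel q => //= fuel IH q; case E: nearest => [q'|//] /=; rewrite IH andbT.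
by have [] := (nearestP _ _).1 E; rewrite inE => /andP[].
Qed.

Lemma nw_path_closed L fuel (A : {set label * label}) q q' : {in A, forall s : label * label, s.1 < fuel} ->
  q \in nw_path L fuel A -> nearest (pluses_nw_of L q) = Some q' ->
  q' \in nw_path L fuel A.
Proof.
elim: fuel A => //= fuel IH A hA.
case E: nearest => [p|//]; have [pA _] := (nearestP _ _).1 E.
have hp : {in pluses_nw_of L p, forall s : label * label, s.1 < fuel}.
  move=> s; rewrite inE => /and3P[_ sp _].
  by have := hA _ pA; rewrite ltnS; apply: leq_trans.
rewrite !inE => /predU1P[->|qp] Eq; apply/orP; right; last exact: IH qp Eq.
case: fuel hp {IH hA} => [|fuel] hp /=; last by rewrite Eq mem_head.
by have [/hp] := (nearestP _ _).1 Eq.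
Qed.

End Paths.

(** * A Le diagram is determined by its necklace *)

Section Uniqueness.

Variables (n k : nat) (L : filled_diagram n).
Hypothesis hL : le_diagram k L.
Local Notation label := 'I_n.+1.

Lemma mem_pluses_squares s :
  s \in pluses L -> [/\ s.1 \in rows L, s.2 \notin rows L & s.1 < s.2].
Proof. by case: hL => _ /subsetP h _ /h; rewrite inE => /and3P. Qed.

(** The induction is on the gap b - a.  Without gap, the region consists of the
   squares weakly northwest of the border square a, and q starts the path from
   there. *)
Lemma nearest_region_oh_path a b q : a <= b -> nearest (region L a b) = Some q ->
  exists2 i : label, i != ord0 & q \in oh_path L i.
Proof.
move=> ab; rewrite -(subnKC ab); move: (b - a) => {ab} d.
elim/ltn_ind: d a q => -[|d] IH a q E; have [qA hq] := (nearestP _ _).1 E.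
  move: qA E; rewrite addn0 inE => /and3P[_ qa aq] E.
  have an : a < n.+1 by apply: leq_ltn_trans aq (ltn_ord _).
  exists (Ordinal an); first by rewrite -val_eqE /= -lt0n; case: (a) qa.
  by rewrite /oh_path pluses_nw_of_border_region /= E mem_head.
move: (qA); rewrite inE => /and3P[_ qa bq].
have bn := leq_ltn_trans bq (ltn_ord _).
have an : a < n.+1 by clear -bn; lia.
have b'n : a + d < n.+1 by clear -bn; lia.
pose p := Ordinal an; pose j := Ordinal b'n.
(* If row p has no plus in the columns of the region, adding this row to the
   region does not change its pluses; likewise for column j below. *)
have [/existsP[s /and3P[sL /eqP sp bs]]|noP] :=
    boolP [exists s, [&& s \in pluses L, s.1 == p & a + d.+1 <= s.2]]; last first.
  apply: (IH d (ltnSn d) a.+1 q); rewrite addSnnS -E; congr nearest.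
  apply/setP => s; rewrite !inE; case: (boolP (s \in pluses L)) => //= sL.
  rewrite ltnS leq_eqVlt andb_orl; case: eqP => //= sa; rewrite sa ltnn /= orbF.
  apply: contraNF noP => bs; apply/existsP; exists s; rewrite sL bs andbT /=.
  by apply/eqP/val_inj.
have [/existsP[t /and3P[tL /eqP tj ta]]|noJ] :=
    boolP [exists s, [&& s \in pluses L, s.2 == j & s.1 < a]]; last first.
  apply: (IH d (ltnSn d) a q); rewrite -E; congr nearest.
  apply/setP => x; rewrite !inE addnS; case: (boolP (x \in pluses L)) => //= xL.
  rewrite [a + d <= _]leq_eqVlt andb_orr; case: eqP => [jx|_]; last by rewrite andbF.
  rewrite -jx ltnn andbF orbF andbT.
  apply: contraNF noJ => xa; apply/existsP; exists x; rewrite xL xa andbT /=.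
  by apply/eqP/val_inj.
(* Otherwise the Le condition forces a plus in the corner (p, j), which is
   nearest in the region enlarged by both lines, and q follows it on its path. *)
have [pR _ _] := mem_pluses_squares sL; have [_ jR _] := mem_pluses_squares tL.
rewrite sp in pR; rewrite tj in jR.
have pj : p < j.
  have : p != j by apply: contraNneq jR => <-.
  by rewrite -val_eqE /=; clear; lia.
have pjL : (p, j) \in pluses L.
  case: hL => _ _ /(_ t.1 j p s.2); apply.
  - exact: ta.
  - by rewrite /j /= -addnS.
  - by rewrite -tj -surjective_pairing.
  - by rewrite -sp -surjective_pairing.
  - by rewrite inE /= pR jR.
have [i i0 pji] : exists2 i : label, i != ord0 & (p, j) \in oh_path L i.
  have Epj : nearest (region L a.+1 (a + d)) = Some (p, j).
    apply/nearestP; split; first by rewrite inE pjL /= ltnSn leqnn.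
    by move=> s'; rewrite inE => /and3P[_ h1 h2]; apply/andP.
  have d0 : 0 < d by rewrite /= -addn1 leq_add2l in pj.
  apply: (IH d.-1 _ a.+1 (p, j)); first by rewrite ltnS leq_pred.
  by rewrite addSnnS prednK.
exists i => //; apply: nw_path_closed pji _.
  by move=> s' _; apply: ltn_ord.
by rewrite pluses_nw_of_region /= -addnS.
Qed.

Lemma mem_oh_path (i : label) s : s \in oh_path L i ->
  [/\ s.1 \in rows L, s.2 \notin rows L & s \in pluses L].
Proof.
rewrite /oh_path pluses_nw_of_border_region => /nw_path_region.
by rewrite inE => /and3P[sL _ _]; have [] := mem_pluses_squares sL.
Qed.

(** A path is a chain, so sorting its row labels and its column labels in opposite
   directions and pairing them gives the path back. *)
Lemma placed_pluses_oh_path (i : label) : i != ord0 ->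
  placed_pluses (necklace_of_diagram L) i = oh_path L i.
Proof.
move=> i0; rewrite /placed_pluses !ffunE eqxx (negbTE i0).
set p := oh_path L i; set A := rows L :\: _; set B := _ :\: rows L.
have p_sorted : sorted (fun s t => strictly_nw t s) p by apply: nw_path_sorted.
have pR : {in p, forall s, (s.1 \in rows L) && (s.2 \notin rows L)}.
  by move=> s /mem_oh_path[-> ->].
have -> : rev (enum A) = unzip1 p.
  apply: (@irr_sorted_eq _ (fun x y : label => y < x)).
  - by move=> x y z /= xy zx; apply: ltn_trans zx xy.
  - by move=> x; apply: ltnn.
  - exact: sorted_rev_enum.
  - by rewrite sorted_map; apply: sub_sorted p_sorted => s t /andP[].
  move=> x; rewrite mem_rev mem_enum !inE negb_or negb_and negbK.
  apply/idP/idP => [/andP[/andP[+ _] xR]|xp]; first by rewrite xR orbF.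
  have /andP[] : (x \in rows L) && (x \notin unzip2 p); last first.
    by move=> -> xp2; rewrite xp xp2.
  case/mapP: xp => s sp ->; have /andP[-> _] := pR _ sp => /=.
  apply/negP => /mapP[t tp st]; have /andP[_] := pR _ tp.
  by rewrite -st; have /andP[-> _] := pR _ sp.
have -> : enum B = unzip2 p.
  apply: (@irr_sorted_eq _ (fun x y : label => x < y)).
  - by move=> x y z /=; apply: ltn_trans.
  - by move=> x; apply: ltnn.
  - exact: sorted_enum.
  - by rewrite sorted_map; apply: sub_sorted p_sorted => s t /andP[].
  move=> x; rewrite mem_enum !inE; apply/andP/idP => [[xR]|xp].
    by rewrite (negbTE xR) andbF.
  split; last by rewrite xp orbT.
  by case/mapP: xp => s sp ->; have /andP[_] := pR _ sp.
exact: zip_unzip.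
Qed.

Lemma diagram_of_necklace_of_diagram :
  diagram_of_necklace (necklace_of_diagram L) = L.
Proof.
rewrite /diagram_of_necklace ffunE eqxx; case E : L => [RL PL].
congr FilledDiagram; rewrite -E; apply/setP => -[r c]; apply/bigcupP/idP.
  case=> i i0; rewrite inE placed_pluses_oh_path // => /mem_oh_path[_ _].
  by rewrite E.
move=> rcL; have rcL' : (r, c) \in pluses L by rewrite E.
have [_ _ /= ltrc] := mem_pluses_squares rcL'.
have [] := @nearest_region_oh_path r.+1 c (r, c) ltrc.
  apply/nearestP; split; first by rewrite inE rcL' /= ltnSn leqnn.
  by move=> s; rewrite inE => /and3P[_ h1 h2]; apply/andP.
by move=> i i0 hi; exists i; rewrite // inE placed_pluses_oh_path.
Qed.

End Uniqueness.

(** * The evolution of a necklace *)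

Section Necklace.

Variables (n k : nat) (I : {ffun 'I_n.+1 -> {set 'I_n.+1}}).
Hypothesis hI : grassmann_necklace k I.
Local Notation label := 'I_n.+1.
Local Notation R := (I ord0).

(** Indexing by natural numbers unrolls one turn of the cycle: time n.+1 is time 0
   again, and facts about the wrap-around become inductions up to n.+1. *)
Definition at_ (t : nat) : {set label} := I (inord (t %% n.+1)).

Lemma atE (i : label) : at_ i = I i.
Proof. by rewrite /at_ modn_small // inord_val. Qed.

Lemma at_last : at_ n.+1 = R.
Proof. by rewrite /at_ modnn; congr (I _); apply/val_inj; rewrite /= inordK. Qed.

Lemma at_step (i : label) :
  at_ i.+1 = at_ i \/ i \in at_ i /\ exists j, at_ i.+1 = j |: (at_ i :\ i).
Proof.
have -> : at_ i.+1 = I (ordS i).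
  by congr (I _); apply/val_inj; rewrite /= inordK // ltn_mod.
rewrite atE; have [_] := hI i; case: ifP => h e; last by left.
by right.
Qed.

(** A label can leave only at the step that bears its number. *)
Lemma at_mem (x : label) z z' : z <= z' -> z' <= n.+1 -> x \in at_ z ->
  ~~ (z <= x < z') -> x \in at_ z'.
Proof.
move=> zz'; rewrite -(subnKC zz'); elim: (z' - z) => [|d IH]; first by rewrite addn0.
rewrite addnS => lt xz xN.
have {IH} xd : x \in at_ (z + d) by apply: IH => //; lia.
case: (at_step (Ordinal lt)) => [/= -> //|[_ [j /= ->]]].
by rewrite !inE xd andbT -[x == Ordinal lt]val_eqE /= orbC; case: eqP => //; lia.
Qed.

(** Every step that inserts a label also removes its own number, which lies in X. *)
Lemma at_card_mono (X : {set label}) z z' : z <= z' -> z' <= n.+1 ->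
  (forall x : label, z <= x < z' -> x \in X) ->
  #|at_ z' :&: X| <= #|at_ z :&: X|.
Proof.
move=> zz'; rewrite -(subnKC zz'); elim: (z' - z) => [|d IH]; first by rewrite addn0.
rewrite addnS => lt hX.
apply: leq_trans (IH _ _); [|lia|by move=> x hx; apply: hX; lia].
case: (at_step (Ordinal lt)) => [/= -> //|[iI [j /= ->]]].
set i := Ordinal lt in iI *; have iX : i \in X by apply: hX => /=; lia.
rewrite setIUl setIDAC; apply: leq_trans (leq_card_setU _ _) _.
have -> : #|at_ (z + d) :&: X| = 1 + #|(at_ (z + d) :&: X) :\ i|.
  by rewrite (cardsD1 i) inE iX (iI : _ \in at_ (z + d)).
by rewrite leq_add2r -(cards1 j) subset_leq_card // subsetIl.
Qed.

(** Discrete intermediate value property: a step removes at most one label. *)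
Lemma at_ivt (X : {set label}) m z z' : z <= z' -> z' <= n.+1 ->
  #|at_ z' :&: X| <= m <= #|at_ z :&: X| ->
  exists2 w, z <= w <= z' & #|at_ w :&: X| = m.
Proof.
move=> zz'; rewrite -(subnKC zz'); elim: (z' - z) => [|d IH].
  by rewrite addn0 => _ h; exists z; lia.
rewrite addnS => lt hX.
have [le|gt] := leqP #|at_ (z + d) :&: X| m.
  by have [||w hw <-] := IH; [lia|lia|exists w => //; lia].
exists (z + d).+1; first by lia.
suff : #|at_ (z + d) :&: X| <= #|at_ (z + d).+1 :&: X|.+1 by lia.
rewrite (cardsD1 (Ordinal lt)) -[X in _ <= X]add1n leq_add ?leq_b1 //.
apply/subset_leq_card/subsetP => x.
rewrite !inE -val_eqE => /and3P[/= xi xz ->]; rewrite andbT.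
by apply: at_mem xz _; lia.
Qed.

Lemma at_below (x : label) z : x < z -> z <= n.+1 -> x \in at_ z -> x \in R.
Proof. by move=> xz zn xI; rewrite -at_last; apply: at_mem xI _; lia. Qed.

Lemma at_above (x : label) z : z <= x -> x \in R -> x \in at_ z.
Proof.
move=> zx; rewrite -atE => xI; apply: at_mem xI _; rewrite /=; have := ltn_ord x; lia.
Qed.

Lemma mass_at_below a b z : b <= z -> z <= n.+1 -> mass (at_ z) a b <= mass R a b.
Proof.
move=> bz zn; apply: le_mass => x /andP[_ xb]; apply: at_below zn.
exact: leq_trans bz.
Qed.

Lemma mass_at_above a b z : z <= a -> z <= n.+1 -> mass R a b <= mass (at_ z) a b.
Proof.
move=> za zn; apply: le_mass => x /andP[ax _]; apply: at_above.
exact: leq_trans ax.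
Qed.

Lemma itv_of (r c : label) z : z <= n.+1 ->
  r \in R -> r \notin at_ z -> c \in at_ z -> c \notin R -> r < z <= c.
Proof.
move=> zn rR rz cz cR; apply/andP; split; [rewrite ltnNge|rewrite leqNgt]; apply/negP => h.
  by move/negP: rz; apply; apply: at_above.
by move/negP: cR; apply; apply: at_below cz.
Qed.

Lemma card_diff (i : label) : #|R :\: I i| = #|I i :\: R|.
Proof.
have [e0 _] := hI ord0; have [ei _] := hI i.
have := cardsID (I i) R; have := cardsID R (I i); rewrite setIC; lia.
Qed.

(** The rank condition of [mem_zip_sorted] compares the labels of R :\: I z above r
   with those of I z :\: R below c.  Both kinds lie in the open interval (r, c),
   where adding the common labels of R and I z turns it into an equality of
   counts of R and I z. *)
Lemma mem_placed (z r c : label) :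
  ((r, c) \in placed_pluses I z) =
    [&& r \in R :\: I z, c \in I z :\: R & mass R r.+1 c == mass (I z) r.+1 c].
Proof.
rewrite mem_zip_sorted ?sorted_rev_enum ?sorted_enum ?size_rev -?cardE ?card_diff //.
rewrite mem_rev !mem_enum count_rev !count_enum.
case: (boolP (r \in _)) => //; rewrite inE => /andP[rz rR].
case: (boolP (c \in _)) => //=; rewrite inE => /andP[cR cz].
have zn : z <= n.+1 by exact: ltnW.
have h : r < z <= c by apply: itv_of; rewrite ?atE.
set X := itv n r.+1 c.
have -> : (R :\: I z) :&: [set x | r < nat_of_ord x] = (R :&: X) :\: I z.
  apply/setP => x; rewrite !inE; case: (boolP (x \in R)) => xR; rewrite ?andbF //=.
  have [//|xI] := boolP (x \in I z).
  suff : x < z by lia.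
  by rewrite ltnNge; apply: contra xI => zx; rewrite -atE; apply: at_above.
have -> : (I z :\: R) :&: [set x | nat_of_ord x < c] = (I z :&: X) :\: R.
  apply/setP => x; rewrite !inE; case: (boolP (x \in I z)) => xI; rewrite ?andbF //=.
  have [//|xR] := boolP (x \in R).
  suff : z <= x by lia.
  by rewrite leqNgt; apply: contra xR => zx; apply: (@at_below _ z); rewrite ?atE.
rewrite /mass -/X -(cardsID (I z) (R :&: X)) -(cardsID R (I z :&: X)).
have -> : I z :&: X :&: R = R :&: X :&: I z by rewrite setIC setIA setIAC.
by rewrite eqn_add2l.
Qed.

(** * The constructed filling is a Le diagram *)

Local Notation D := (diagram_of_necklace I).

Definition plus_at z (r c : label) : Prop :=
  [/\ r \in R, r \notin at_ z, c \in at_ z, c \notin R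
    & mass R r.+1 c = mass (at_ z) r.+1 c].

Lemma mem_pluses (r c : label) :
  reflect (exists z : label, plus_at z r c) ((r, c) \in pluses D).
Proof.
apply: (iffP bigcupP) => [[z _]|[z]].
  rewrite inE mem_placed !inE => /and3P[/andP[? ?] /andP[? ?] /eqP ?].
  by exists z; rewrite /plus_at atE.
rewrite /plus_at atE => -[rR rz cz cR e]; exists z.
  by apply: contraNneq rz => ->.
by rewrite inE mem_placed !inE rR rz cz cR e eqxx.
Qed.

Lemma plus_at_itv z (r c : label) : z <= n.+1 -> plus_at z r c -> r < z <= c.
Proof. by move=> zn [rR rz cz cR _]; apply: itv_of. Qed.

Lemma necklace_well_defined : diagram_of_necklace_well_defined I.
Proof.
move=> i _; split=> [|[r c]]; first exact: card_diff.
rewrite mem_placed !inE => /and3P[/andP[rz rR] /andP[cR cz] _] /=.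
rewrite rR cR /=; have := @itv_of r c i; rewrite atE => h.
have /andP[] : r < i <= c by apply: h => //; exact: ltnW.
by move=> ri; apply: leq_trans.
Qed.

(** A plus in row p, to the left of column j, keeps p out of the sets from time p + 1
   up to its own time and bounds the count in (p, j) from above by that of R; [plus_at_col] is
   the mirror image.  The times are truncated to stay within (p, j]. *)
Lemma plus_at_row z (p l j : label) : z <= n.+1 -> plus_at z p l -> p < j < l ->
  p \notin at_ (minn z j) /\ mass (at_ (minn z j)) p.+1 j <= mass R p.+1 j.
Proof.
move=> zn hz pjl; have hy := plus_at_itv zn hz.
case: hz => _ pz _ _ e; split.
  by apply: contra pz => pI; apply: at_mem pI _; clear e; lia.
have [zj|/ltnW jz] := leqP z j; last first.
    by apply: mass_at_below => //; apply/ltnW.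
move: e; rewrite !(@mass_cat n _ p.+1 j l); try by clear -pjl; lia.
by have := mass_at_above l zj zn; lia.
Qed.

Lemma plus_at_col z (i j p : label) : z <= n.+1 -> plus_at z i j -> i < p < j ->
  j \in at_ (maxn z p.+1) /\ mass R p.+1 j <= mass (at_ (maxn z p.+1)) p.+1 j.
Proof.
move=> zn hz ipj; have hx := plus_at_itv zn hz; have jn := ltn_ord j.
case: hz => _ _ jz _ e; split.
  by apply: at_mem jz _; clear e; lia.
have [pz|zp] := leqP p.+1 z; last by apply: mass_at_above; lia.
move: e; rewrite !(@mass_cat n _ i.+1 p.+1 j); try by clear -ipj; lia.
by have := mass_at_below i.+1 pz zn; lia.
Qed.

(** If the times were in the wrong order, then p would be absent at time y, and the
   count in [p, j) could not grow from y to x; but the plus (i, j) at time x makes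
   that count exceed the count of R in (p, j), which bounds it at time y. *)
Lemma plus_at_order x y (i j p l : label) : x <= n.+1 -> y <= n.+1 ->
  plus_at x i j -> plus_at y p l -> i < p -> p < j -> j < l ->
  maxn x p.+1 <= minn y j.
Proof.
move=> xn yn hx hy ip pj jl; rewrite leqNgt; apply/negP => lt.
have [ix xj] := andP (plus_at_itv xn hx).
have [py yl] := andP (plus_at_itv yn hy).
have [ey yx] : minn y j = y /\ (p < y) && (y <= x <= j) by clear -lt pj py xj; lia.
have [_ le_y] := plus_at_row yn hy (introT andP (conj pj jl)).
case: hx hy => _ _ _ _ ex [pR py' _ _ _]; rewrite ey in le_y.
have : mass (at_ x) p j <= mass (at_ y) p j.
  apply: at_card_mono => [||q hq] //; first by clear -yx; lia.
  by rewrite inE; clear -hq yx; lia.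
rewrite !mass_recl // (negbTE py') add0n => le1.
move: ex; rewrite !(@mass_cat n _ i.+1 p j); try by clear -ip pj; lia.
rewrite !(@mass_recl n _ p j) // pR.
have px : p <= x by clear -yx; lia.
have := mass_at_below i.+1 px xn.
by move: le1 le_y; clear; lia.
Qed.

Lemma necklace_le_diagram : le_diagram k D.
Proof.
split; first by have [] := hI ord0.
  apply/bigcupsP => i i0; apply/subsetP => s; rewrite inE => sP.
  by have [_] := necklace_well_defined i0; apply.
move=> i j p l ip jl /mem_pluses[x hx] /mem_pluses[y hy].
rewrite inE => /and3P[/= _ _ pj].
have [xn yn jn] := And3 (ltnW (ltn_ord x)) (ltnW (ltn_ord y)) (ltn_ord j).
have le := plus_at_order xn yn hx hy ip pj jl.
have [py le_y] := plus_at_row yn hy (introT andP (conj pj jl)).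
have [jx le_x] := plus_at_col xn hx (introT andP (conj ip pj)).
have yjn : minn y j <= n.+1 by clear -yn; lia.
have [|w hw e] := @at_ivt (itv n p.+1 j) (mass R p.+1 j) _ _ le yjn.
  by apply/andP.
have wn : w < n.+1 by clear -hw jn; lia.
have {}hw : [/\ w <= minn y j, p < w, maxn x p.+1 <= w & w <= j].
  by split; clear -hw; lia.
case: hw => wy pw xw wj.
apply/mem_pluses; exists (Ordinal wn); case: hx hy => _ _ _ jR _ [pR _ _ _ _].
split=> //=.
  by apply: contra py => pI; apply: at_mem pI _; rewrite // negb_and -ltnNge pw.
by apply: at_mem jx _; rewrite ?(ltnW wn) // negb_and -(leqNgt w) wj orbT.
Qed.

(** * The paths of the constructed diagram *)

(** Here time i is not later than z.  If I_i had only labels of R in [b, c], it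
   would have at most as many labels as R in [a, c].  This bound persists until
   time z, at which c is present but not in R; so I_z would have fewer labels than
   R in (r, c), against the plus (r, c). *)
Lemma plus_at_after (i z : nat) a b (r c : label) : a <= i <= b ->
  i <= z -> z <= n.+1 -> mass R a b = mass (at_ i) a b ->
  plus_at z r c -> r < a -> b <= c ->
  exists2 x : label, b <= x <= c & x \in at_ i :\: R.
Proof.
move=> /andP[ai ib] iz zn cut hz ra bc.
apply/exists_inP; apply: contraT => /exists_inPn h.
have hR : mass (at_ i) b c.+1 <= mass R b c.+1.
  apply: le_mass => x; rewrite ltnS => xbc xi.
  by apply: contraT => xR; have := h _ xbc; rewrite inE xR xi.
have /andP[rz zc] := plus_at_itv zn hz.
have : mass (at_ z) a c.+1 <= mass (at_ i) a c.+1.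
  apply: at_card_mono => [||x hx] //.
  by rewrite inE; clear -hx ai zc; lia.
have az := leq_trans ai iz; have ac := leq_trans az zc.
have := mass_at_below r.+1 az zn.
case: hz => _ _ cz cR e.
move: e; rewrite !(@mass_cat n _ r.+1 a c) // !(mass_recr _ ac) cz.
have ab := leq_trans ai ib.
move: hR; rewrite (mass_recr R) // (negbTE cR) !addn0.
have := mass_cat R ab bc; have := mass_cat (at_ i) ab (leqW bc).
rewrite (mass_recr _ ac).
by move: cut; clear; lia.
Qed.

(** The mirror image of [plus_at_after]: if R had only labels of I_i in [r, a), then
   I_i, and hence the earlier I_z, would have at least as many labels as R in
   [r, b), although r is missing from I_z. *)
Lemma plus_at_before (i z : nat) a b (r c : label) : a <= i <= b ->
  z <= i -> i <= n.+1 -> mass R a b = mass (at_ i) a b ->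
  plus_at z r c -> r < a -> b <= c ->
  exists2 x : label, r <= x < a & x \in R :\: at_ i.
Proof.
move=> /andP[ai ib] zi iN cut hz ra bc.
apply/exists_inP; apply: contraT => /exists_inPn h.
have hR : mass R r a <= mass (at_ i) r a.
  apply: le_mass => x xra xR.
  by apply: contraT => xi; have := h _ xra; rewrite inE xR xi.
have zn := leq_trans zi iN; have /andP[rz zc] := plus_at_itv zn hz.
have : mass (at_ i) r b <= mass (at_ z) r b.
  apply: at_card_mono => [||x hx] //.
  by rewrite inE; clear -hx rz ib; lia.
have ab := leq_trans ai ib; have rb := leq_trans ra ab.
have := mass_at_above c (leq_trans zi ib) zn.
case: hz => rR rz' _ _ e.
move: e; rewrite !(@mass_cat n _ r.+1 b c) //.
have := mass_cat R (ltnW ra) ab; have := mass_cat (at_ i) (ltnW ra) ab.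
rewrite (mass_recl R rb) (mass_recl (at_ z) rb) rR (negbTE rz') /=.
by move: cut hR; clear; lia.
Qed.

(** The lists s and t are what remains of the two differences of R and I_i inside
   the region.  The equality of counts in [a, b) is what survives the removal of
   the first pair: the new interval [r, c + 1) gains r, which only R contains, and
   c, which only I_i contains. *)
Lemma nw_path_zip (i : label) fuel a b s t : a <= i <= b ->
  mass R a b = mass (at_ i) a b ->
  sorted (fun x y : label => y < x) s -> sorted (fun x y : label => x < y) t ->
  size s = size t -> size s <= fuel ->
  (forall x, (x \in s) = (x \in R :\: at_ i) && (x < a)) ->
  (forall x, (x \in t) = (x \in at_ i :\: R) && (b <= x)) ->
  nw_path D fuel (region D a b) = zip s t.
Proof.
elim: s t fuel a b => [|r s IH] [|c t] // [|fuel] a b //= aib cut ss st.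
  move=> _ _ hs ht; case E: nearest => [[r c]|//].
  have [] := (nearestP _ _).1 E; rewrite inE => /and3P[/= + ra bc] _.
  case/mem_pluses=> z hz; have [zn iN] := conj (ltnW (ltn_ord z)) (ltnW (ltn_ord i)).
  have [iz|/ltnW zi] := leqP i z.
    have [x /andP[bx _] hx] := plus_at_after aib iz zn cut hz ra bc.
    by have := ht x; rewrite hx bx.
  have [x /andP[_ xa] hx] := plus_at_before aib zi iN cut hz ra bc.
  by have := hs x; rewrite hx xa.
move=> [sz] fs hs ht.
have [ai ib] := andP aib; have iN := ltnW (ltn_ord i).
have sr : {in s, forall x : label, x < r}.
  by apply/allP; apply: order_path_min ss => x y z /= xy zx; apply: ltn_trans zx xy.
have tc : {in t, forall x : label, c < x}.
  by apply/allP; apply: order_path_min st => x y z /=; apply: ltn_trans.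
have := hs r; rewrite mem_head inE => /esym/andP[/andP[ri rR] ra].
have := ht c; rewrite mem_head inE => /esym/andP[/andP[cR ci] bc].
have hr x : x \in R :\: at_ i -> x < a -> x <= r.
  by move=> h xa; have := hs x; rewrite h xa !inE => /predU1P[->|/sr/ltnW].
have hc x : x \in at_ i :\: R -> b <= x -> c <= x.
  by move=> h bx; have := ht x; rewrite h bx !inE => /predU1P[->|/tc/ltnW].
have rc : plus_at i r c.
  split=> //; rewrite !(@mass_cat n _ r.+1 a c) ?(leq_trans ai) ?(leq_trans ib) //.
  rewrite !(@mass_cat n _ a b c) ?(leq_trans ai) // cut.
  congr (_ + (_ + _)); apply: eq_mass => x /andP[h1 h2].
    apply/idP/idP => [xR|]; last by apply: at_below iN; apply: leq_trans ai.
    apply: contraT => xi; have := hr x; rewrite inE xi xR => /(_ isT h2).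
    by rewrite leqNgt h1.
  apply/idP/idP => [|xi]; first by apply: at_above; apply: leq_trans h1.
  apply: contraT => xR; have := hc x; rewrite inE xi xR => /(_ isT h1).
  by rewrite leqNgt h2.
have -> : nearest (region D a b) = Some (r, c).
  apply/nearestP; split.
    by rewrite inE /= ra bc !andbT; apply/mem_pluses; exists i.
  move=> [r' c']; rewrite inE => /and3P[/= /mem_pluses[z hz] ra' bc'].
  have zn := ltnW (ltn_ord z); rewrite /weakly_nw /=.
  have [iz|/ltnW zi] := leqP i z; apply/andP; split.
  - apply: hr => //; case: hz => r'R r'z _ _ _; rewrite inE r'R andbT.
    apply: contra r'z => r'i; apply: at_mem r'i _ => //.
    by rewrite negb_and -ltnNge (leq_trans ra' ai).
  - have [x /andP[bx xc] hx] := plus_at_after aib iz zn cut hz ra' bc'.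
    exact: leq_trans (hc _ hx bx) xc.
  - have [x /andP[rx xa] hx] := plus_at_before aib zi iN cut hz ra' bc'.
    exact: leq_trans rx (hr _ hx xa).
  apply: hc => //; case: hz => _ _ c'z c'R _; rewrite inE c'R /=.
  apply: at_mem c'z _ => //.
  by rewrite negb_and -!leqNgt (leq_trans ib bc') orbT.
congr cons; rewrite pluses_nw_of_region /=.
have [rlti clti] := (leq_trans ra ai, leq_trans ib bc).
have rltc := leq_trans rlti clti.
apply: IH => //; rewrite ?(path_sorted ss) ?(path_sorted st) //.
- by rewrite (ltnW rlti) leqW.
- rewrite !mass_recl ?leqW // !mass_recr //.
  by case: rc => _ _ _ _ ->; rewrite rR ci (negbTE ri) (negbTE cR) addn0 addnC.
- move=> x; apply/idP/andP => [xs|[h xr]].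
    by have := hs x; rewrite in_cons xs orbT => /esym/andP[-> _]; rewrite sr.
  by have := hs x; rewrite h (ltn_trans xr ra) => /predU1P[e|//]; rewrite e ltnn in xr.
move=> x; apply/idP/andP => [xt|[h cx]].
  by have := ht x; rewrite in_cons xt orbT => /esym/andP[-> _]; rewrite tc.
by have := ht x; rewrite h (leq_trans bc (ltnW cx)) => /predU1P[e|//]; rewrite e ltnn in cx.
Qed.

Lemma oh_path_placed (i : label) : oh_path D i = placed_pluses I i.
Proof.
rewrite /oh_path pluses_nw_of_border_region.
apply: (@nw_path_zip i); rewrite ?leqnn ?sorted_rev_enum ?sorted_enum //.
- by apply: eq_mass => x; clear; lia.
- by rewrite size_rev -!cardE card_diff.
- by rewrite size_rev -cardE -[X in _ <= X]card_ord max_card.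
- move=> x; rewrite mem_rev mem_enum atE; case: (boolP (x \in _)) => //.
  rewrite inE => /andP[xi xR]; apply/esym; rewrite ltnNge.
  by apply: contra xi => ix; rewrite -atE; apply: at_above.
move=> x; rewrite mem_enum atE; case: (boolP (x \in _)) => //.
rewrite inE => /andP[xR xi]; apply/esym; rewrite leqNgt.
by apply: contra xR => ix; apply: (@at_below _ i); rewrite ?atE // ltnW.
Qed.

Lemma necklace_of_diagram_of_necklace : necklace_of_diagram D = I.
Proof.
apply/ffunP => i; rewrite ffunE oh_path_placed; case: eqP => [-> //|_].
have sz : size (rev (enum (R :\: I i))) = size (enum (I i :\: R)).
  by rewrite size_rev -!cardE card_diff.
rewrite -/(unzip1 _) -/(unzip2 _) unzip1_zip ?unzip2_zip ?sz //=.
apply/setP => x; rewrite !inE mem_rev !mem_enum !inE.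
by case: (x \in R); case: (x \in I i).
Qed.

End Necklace.

Theorem theorem4p4 (n k : nat) (hk : k <= n.+1)
    (I : {ffun 'I_n.+1 -> {set 'I_n.+1}}) (hI : grassmann_necklace k I) :
  [/\ diagram_of_necklace_well_defined I,
      le_diagram k (diagram_of_necklace I),
      necklace_of_diagram (diagram_of_necklace I) = I
    & forall L : filled_diagram n,
        le_diagram k L -> necklace_of_diagram L = I ->
        L = diagram_of_necklace I].
Proof.
split.
- exact: necklace_well_defined hI.
- exact: necklace_le_diagram.
- exact: necklace_of_diagram_of_necklace hI.
by move=> L hL <-; rewrite (diagram_of_necklace_of_diagram hL).
Qed.
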